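(* Every separable Hausdorff continuum with only countably many non-cut points is a dendrite.
   Context: A continuum is a connected compact Hausdorff space. A point $x$ of a connected space $X$ is a cut point if $X\setminus\{x\}$ is disconnected; otherwise it is a non-cut point. Two points $a,b$ of a connected space $X$ are separated by a third point $c$ if $X\setminus\{c\}$ is the union of two disjoint open sets, one containing $a$ and the other containing $b$. A connected space is dendritic if every two (distinct) points are separated by some other point. A dendron is a dendritic compact Hausdorff space, and a dendrite is a metrizable dendron. *)

(* Defs.v *)
From mathcomp Require Import all_boot all_order all_algebra.
From mathcomp Require Import all_classical all_reals.
From mathcomp Require Import topology.

Set Implicit Arguments.
Unset Strict Implicit.
Unset Printing Implicit Defensive.

Local Open Scope classical_set_scope.

(* [connected set0] holds, so the empty space counts as a continuum, as in the
   definition "connected compact Hausdorff space" read literally. *)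
Definition continuum (X : topologicalType) : Prop :=
  [/\ connected [set: X], compact [set: X] & hausdorff_space X].

Definition cut_point (X : topologicalType) (x : X) : Prop :=
  ~ connected [set~ x].

Definition non_cut_points (X : topologicalType) : set X :=
  [set x | ~ cut_point x].
Arguments non_cut_points : clear implicits.

Definition separable_space (X : topologicalType) : Prop :=
  exists2 D : set X, countable D & dense D.

(* [c <> a] and [c <> b] follow from [U `|` V = [set~ c]].
   [U] and [V] are open in [X]; when points are closed this is the same as
   being open in the subspace [[set~ c]]. *)
Definition separated_by (X : topologicalType) (c a b : X) : Prop :=
  exists U V : set X,
    [/\ open U, open V, U `&` V = set0, U `|` V = [set~ c] & U a /\ V b].

Definition dendritic (X : topologicalType) : Prop :=
  connected [set: X] /\
  forall a b : X, a <> b -> exists c : X, separated_by c a b.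

Definition dendron (X : topologicalType) : Prop :=
  [/\ dendritic X, compact [set: X] & hausdorff_space X].

(* Being homeomorphic to a metric space. *)
Definition metrizable (R : realType) (X : topologicalType) : Prop :=
  exists (M : metricType R) (f : X -> M) (g : M -> X),
    [/\ cancel f g, cancel g f, continuous f & continuous g].

Definition dendrite (R : realType) (X : topologicalType) : Prop :=
  dendron X /\ metrizable R X.

(* Main.v *)
(* Call an open set [V] missing [c] a lobe at [c] when [V] together with [c] is
   closed. If neither of two lobes at distinct points contains the point of the
   other, their intersection is clopen, hence empty.

   Dendricity. Suppose no point separates [a] from [b]. Then every cut point
   has a nonempty lobe missing [a] and [b]. The cut points lying in no such
   lobe have pairwise disjoint lobes, so by separability they are countably
   many, and the set [F] of all points lying in no such lobe is countable.
   Take [f] continuous with [f a = 0], [f b = 1], and [t] in (0, 1) outside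
   [f @` F]. The compact fibre of [t] is covered by finitely many lobes, and
   removing finitely many lobes does not separate [a] from [b], although [f]
   misses [t] on what remains.

   Metrizability. Let [D] be countable and dense. For [x <> y], a chain of cut
   points between them yields [d], [e], [d'], [e'] in [D] such that every cut
   point splitting [{d, e}] from [{d', e'}] also splits [x] from [y]. Choosing
   one Urysohn function for each quadruple in [D] gives a countable point
   separating family. *)
Require Import Defs.
From HB Require Import structures.
From mathcomp Require Import all_boot all_order all_algebra.
From mathcomp Require Import lra.
From mathcomp Require Import all_classical all_reals.
From mathcomp Require Import interval_inference.
From mathcomp Require Import topology normedtype sequences lebesgue_measure.

Import Order.TTheory GRing.Theory Num.Theory.
Import numFieldNormedType.Exports.

Set Implicit Arguments.
Unset Strict Implicit.
Unset Printing Implicit Defensive.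

Local Open Scope classical_set_scope.
Local Open Scope ring_scope.

(** * Lobes and splittings at a point of a connected space *)

Definition lobe (X : topologicalType) (c : X) (V : set X) : Prop :=
  [/\ open V, ~ V c & closed (V `|` [set c])].

(** Names the two sides, which may be empty, so that splittings at different points can be
    compared. *)
Definition splits (X : topologicalType) (c : X) (U V : set X) : Prop :=
  [/\ open U, open V, U `&` V = set0 & U `|` V = [set~ c]].

Lemma lobe_disjoint (X : topologicalType) (c d : X) (V W : set X) :
  connected [set: X] -> c <> d -> lobe c V -> lobe d W -> ~ W c -> ~ V d ->
  V `&` W = set0.
Proof.
move=> cX cd [oV Vc clV] [oW Wd clW] Wc Vd.
apply: contrapT => /eqP/set0P VW0.
have : V `&` W = [set: X].
  apply: cX => //; first by exists (V `&` W); [exact: openI|rewrite setTI].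
  (* Adding the base points does not enlarge the intersection: [c] is neither in [W] nor equal to
     [d], and [d] is not in [V]. *)
  exists ((V `|` [set c]) `&` (W `|` [set d])); first exact: closedI.
  rewrite setTI; apply/seteqP; split=> z /=; first by case=> Vz Wz; split; left.
  by move=> [[Vz|zc] [Wz|zd]]; subst.
by move/seteqP => [_ /(_ c I)[]].
Qed.

Lemma splitsC (X : topologicalType) (c : X) (U V : set X) :
  splits c U V -> splits c V U.
Proof. by move=> [oU oV UV0 UVc]; split=> //; rewrite 1?setIC 1?setUC. Qed.

Lemma splits_cover (X : topologicalType) (c : X) (U V : set X) (z : X) :
  splits c U V -> z <> c -> U z \/ V z.
Proof. by move=> [_ _ _ UVc] zc; have : [set~ c] z by []; rewrite -UVc. Qed.

Lemma splits_disjoint (X : topologicalType) (c : X) (U V : set X) (z : X) :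
  splits c U V -> U z -> ~ V z.
Proof. by move=> [_ _ UV0 _] Uz Vz; have : (U `&` V) z by []; rewrite UV0. Qed.

Lemma splits_lobe (X : topologicalType) (c : X) (U V : set X) :
  splits c U V -> lobe c U.
Proof.
move=> sUV; have [oU oV UV0 UVc] := sUV.
have UVnc : ~ (U `|` V) c by rewrite UVc; exact.
have Uc : ~ U c by move=> Uc; apply: UVnc; left.
have Vc : ~ V c by move=> Vc; apply: UVnc; right.
split=> //; suff -> : U `|` [set c] = ~` V by exact: open_closedC.
apply/seteqP; split=> z /=; first by case=> [/(splits_disjoint sUV)|->].
move=> Vz; have [->|/(splits_cover sUV)[Uz|//]] := pselect (z = c).
  by right.
by left.
Qed.

(** [U] and [V'] are lobes, neither containing the base point of the other, so they are disjoint;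
    both inclusions follow by taking complements. *)
Lemma splits_sub (X : topologicalType) (c c' : X) (U V U' V' : set X) :
  connected [set: X] -> splits c U V -> splits c' U' V' -> V c' -> U' c ->
  U `|` [set c] `<=` U' /\ V' `|` [set c'] `<=` V.
Proof.
move=> cX s s' Vc' U'c.
have [_ Vc _] := splits_lobe (splitsC s); have [_ U'c' _] := splits_lobe s'.
have UV' : U `&` V' = set0.
  apply: (lobe_disjoint cX _ (splits_lobe s) (splits_lobe (splitsC s'))).
  - by move=> e; subst.
  - exact: splits_disjoint s' _.
  - by move=> Uc'; exact: (splits_disjoint s Uc').
have {}UV' z : U z -> V' z -> False.
  by move=> Uz V'z; have : (U `&` V') z by []; rewrite UV'.
split=> z /= [h|->] //.
- have [e|/(splits_cover s')[//|/(UV' _ h)//]] := pselect (z = c').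
  by subst; case: (splits_disjoint s h).
- have [e|/(splits_cover s)[/UV'/(_ h)//|//]] := pselect (z = c).
  by subst; case: (splits_disjoint s' U'c).
Qed.

(** * Nested splittings in dendritic spaces *)

Lemma splits_refine (X : topologicalType) (x c' : X) (U' V' : set X) :
  dendritic X -> splits c' U' V' -> U' x ->
  exists c U V, [/\ splits c U V, U x, U `|` [set c] `<=` U' &
    V' `|` [set c'] `<=` V].
Proof.
move=> [cX dX] s' U'x; have [_ U'c' _] := splits_lobe s'.
have [|c [U [V [oU oV UV0 UVc [Ux Vc']]]]] := dX x c'; first by move=> e; subst.
have s : splits c U V by [].
exists c, U, V; have [_ Vc _] := splits_lobe (splitsC s).
(* If [c] were in [V'], then [U'] would lie inside [V], although [x] is in [U'] and in [U]. *)
suff U'c : U' c by have [] := splits_sub cX s s' Vc' U'c.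
have [e|/(splits_cover s')[//|V'c]] := pselect (c = c'); first by subst.
have [sub _] := splits_sub cX s' (splitsC s) V'c Vc'.
by case: (splits_disjoint s Ux); apply: sub; left.
Qed.

(* Between the cut point of the refinement and the original one there is room
   for a further cut point, so that [V `&` U'] is nonempty. *)
Lemma splits_refine_gap (X : topologicalType) (x c' : X) (U' V' : set X) :
  dendritic X -> splits c' U' V' -> U' x ->
  exists c U V, [/\ splits c U V, U x, U `|` [set c] `<=` U',
    V' `|` [set c'] `<=` V & V `&` U' !=set0].
Proof.
move=> dX s' U'x.
have [c1 [U1 [V1 [s1 U1x U1U' V'V1]]]] := splits_refine dX s' U'x.
have [c2 [U2 [V2 [s2 U2x U2U1 V1V2]]]] := splits_refine dX s1 U1x.
exists c2, U2, V2; split=> //.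
- by move=> z /U2U1 U1z; apply: U1U'; left.
- by move=> z /V'V1 V1z; apply: V1V2; left.
- by exists c1; split; [apply: V1V2|apply: U1U']; right.
Qed.

(* If [c] were in [U0], the points of [V0] would all lie on one side of [c], so
   [e] and [e'] would not be split. Hence [c] misses [U1 `|` [set c1]], which
   therefore lies on the side of [d]. *)
Lemma splits_pin (X : topologicalType) (c0 c1 : X) (U0 V0 U1 V1 : set X)
    (d e e' : X) :
  connected [set: X] -> splits c0 U0 V0 -> splits c1 U1 V1 ->
  U1 `|` [set c1] `<=` U0 -> U1 d -> V0 e -> V0 e' ->
  forall c U V, splits c U V -> U d -> U e -> V e' -> U1 `<=` U.
Proof.
move=> cX s0 s1 U1U0 U1d V0e V0e' c U V s Ud Ue Ve'.
have [_ Uc _] := splits_lobe s; have [_ Vc _] := splits_lobe (splitsC s).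
have disj (A B : set X) z : A `&` B = set0 -> A z -> B z -> False.
  by move=> AB Az Bz; have : (A `&` B) z by []; rewrite AB.
have U0c : ~ U0 c.
  move=> U0c; have V0c : ~ V0 c := splits_disjoint s0 U0c.
  have [_ U0c0 _] := splits_lobe s0.
  have cc0 : c <> c0 by move=> h; subst.
  have [|Uc0|Vc0] := splits_cover s (z := c0); first by move=> h; subst.
  - have Vc0 := splits_disjoint s Uc0.
    have := lobe_disjoint cX cc0 (splits_lobe (splitsC s))
      (splits_lobe (splitsC s0)) V0c Vc0.
    by move/disj/(_ Ve' V0e').
  - have Uc0 : ~ U c0 by move=> /(splits_disjoint s).
    have := lobe_disjoint cX cc0 (splits_lobe s)
      (splits_lobe (splitsC s0)) V0c Uc0.
    by move/disj/(_ Ue V0e).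
have U1c : ~ U1 c by move=> U1c; apply: U0c; apply: U1U0; left.
have cc1 : c <> c1 by move=> h; apply: U0c; apply: U1U0; right.
have [|Uc1|Vc1] := splits_cover s (z := c1); first by move=> h; subst.
- have := lobe_disjoint cX cc1 (splits_lobe (splitsC s)) (splits_lobe s1) U1c
    (splits_disjoint s Uc1).
  move=> VU1 z U1z; have [h|] := pselect (z = c); first by subst.
  by move=> /(splits_cover s)[//|Vz]; case: (disj _ _ _ VU1 Vz U1z).
- have Uc1 : ~ U c1 by move=> /(splits_disjoint s).
  have := lobe_disjoint cX cc1 (splits_lobe s) (splits_lobe s1) U1c Uc1.
  by move/disj/(_ Ud U1d).
Qed.

(** [d] is taken in the innermost piece [U2] around [x], and [e] in the gap between [c1] and [c]. As
    [e] and every far point [e'] lie in [V1], [splits_pin] puts all of [U2], hence [x], on the side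
    of [d]. *)
Lemma splits_side (X : topologicalType) (D : set X) (x c0 : X)
    (U0 V0 : set X) :
  dendritic X -> dense D -> splits c0 U0 V0 -> U0 x ->
  exists d e c U V, [/\ D d, D e, U d & U e] /\
    [/\ splits c U V, U `|` [set c] `<=` U0, V0 `|` [set c0] `<=` V &
      forall e' c' U' V', V e' -> splits c' U' V' -> U' d -> U' e -> V' e' ->
        U' x].
Proof.
move=> dX dD s0 U0x; have [cX _] := dX.
have [c [U [V [s Ux UU0 V0V]]]] := splits_refine dX s0 U0x.
have [c1 [U1 [V1 [s1 U1x U1U VV1 V1U]]]] := splits_refine_gap dX s Ux.
have [c2 [U2 [V2 [s2 U2x U2U1 V1V2]]]] := splits_refine dX s1 U1x.
have [oU _ _ _] := s; have [_ oV1 _ _] := s1; have [oU2 _ _ _] := s2.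
have [e [[V1e Ue] De]] := dD _ V1U (openI oV1 oU).
have [|d [U2d Dd]] := dD U2 _ oU2; first by exists x.
exists d, e, c, U, V; split; split=> //.
  by apply: U1U; left; apply: U2U1; left.
move=> e' c' U' V' Ve' s' U'd U'e V'e'.
apply: (splits_pin cX s1 s2 U2U1 U2d V1e _ s' U'd U'e V'e') => //.
by apply: VV1; left.
Qed.

(** * Dendricity from countability of the non-cut points *)

Lemma cut_point_lobe (X : topologicalType) (a b c : X) :
  hausdorff_space X -> cut_point c -> ~ separated_by c a b ->
  exists V, [/\ lobe c V, V !=set0, ~ V a & ~ V b].
Proof.
move=> hX /connectedPn[E [E0 EU sE]] nab.
have [oE0 oE1] : open (E false) /\ open (E true).
  have oc : open [set~ c].
    by apply: closed_openC; exact/accessible_closed_set1/hausdorff_accessible.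
  (* Each of two separated pieces of the open set [[set~ c]] is the part outside the closure of the
     other, hence open. *)
  have openE (A B : set X) : [set~ c] = A `|` B -> separated A B -> open A.
    move=> AB [_ cB]; suff -> : A = [set~ c] `&` ~` closure B.
      by apply: openI => //; exact/closed_openC/closed_closure.
    apply/seteqP; split=> z.
      move=> Az; split; first by rewrite AB; left.
      by move=> Bz; have : (A `&` closure B) z by []; rewrite cB.
    by rewrite AB => -[[//|Bz] []]; exact: subset_closure.
  split; first exact: openE EU sE.
  by apply: (openE _ (E false)); [rewrite setUC|rewrite separatedC].
have s : splits c (E false) (E true) by split=> //; exact: separated_disjoint.
have s' := splitsC s.
(* Since [a] and [b] are not on opposite sides of [c], one of the sides misses both. *)
have [E1ab|/not_andP E1ab] := pselect (~ E true a /\ ~ E true b).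
  by exists (E true); have [] := E1ab; split=> //; exact: splits_lobe s'.
have sep U V : splits c U V -> U a -> V b -> separated_by c a b.
  by move=> [? ? ? ?] Ua Vb; exists U, V.
exists (E false); split=> //; first exact: splits_lobe s.
- case: E1ab => /contrapT E1; first exact: splits_disjoint s' E1.
  by move=> E0a; apply: nab; apply: sep s E0a E1.
- case: E1ab => /contrapT E1; last exact: splits_disjoint s' E1.
  by move=> E0b; apply: nab; apply: sep s' E1 E0b.
Qed.

Lemma closed_avoid (X : topologicalType) (s : seq (set X)) :
  (forall V, V \in s -> open V) ->
  closed [set z | forall V, V \in s -> ~ V z].
Proof.
move=> sV.
have -> : [set z | forall V, V \in s -> ~ V z] =
    ~` (\bigcup_(V in [set V | V \in s]) V).
  apply/seteqP; split=> z; first by move=> Yz [W Ws Wz]; exact: Yz Ws Wz.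
  by move=> nz W Ws Wz; apply: nz; exists W.
by apply: open_closedC; apply: bigcup_open => W; exact: sV.
Qed.

(* Each lobe removed is glued back to the side containing its base point. *)
Lemma lobes_nonseparating (X : topologicalType) (a b : X) (s : seq (set X)) :
  connected [set: X] ->
  (forall V, V \in s -> exists c, [/\ lobe c V, ~ V a & ~ V b]) ->
  forall P Q : set X, closed P -> closed Q -> P a -> Q b -> P `&` Q = set0 ->
  P `|` Q <> [set z | forall V, V \in s -> ~ V z].
Proof.
move=> cX; elim: s => [|V s IH] sV P Q cP cQ Pa Qb PQ0 PQ.
  have PQT : P `|` Q = setT by rewrite PQ; apply/seteqP; split.
  suff PT : P = setT.
    have : (P `&` Q) b by split=> //; rewrite PT.
    by rewrite PQ0.
  have PCQ : P = ~` Q.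
    apply/seteqP; split=> z.
      by move=> Pz Qz; have : (P `&` Q) z by []; rewrite PQ0.
    by have [//|Qz /(_ Qz)] : (P `|` Q) z by rewrite PQT.
  apply: cX; first by exists a.
  - by exists (~` Q); [exact: closed_openC|rewrite setTI -PCQ].
  - by exists P => //; rewrite setTI.
have [c [[oV Vc clV] Va Vb]] := sV V (mem_head _ _).
pose Y := [set z : X | forall W, W \in s -> ~ W z].
have clY : closed Y.
  apply: closed_avoid => W Ws.
  by have [|c' [[]]] := sV W; first by rewrite inE Ws orbT.
(* What is glued back is the closed lobe, cut down to the points that survive the other removals. *)
pose L := (V `|` [set c]) `&` Y.
have clL : closed L by exact: closedI.
have sV' W : W \in s -> exists c, [/\ lobe c W, ~ W a & ~ W b].
  by move=> Ws; apply: sV; rewrite inE Ws orbT.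
have PQY z : (P `|` Q) z <-> Y z /\ ~ V z.
  rewrite PQ; split=> [h|[Yz Vz] W].
    by split=> [W Ws|]; apply: h; rewrite inE ?Ws ?orbT ?eqxx.
  by rewrite inE => /orP[/eqP->|/Yz].
have QL A B : A `&` B = set0 -> ~ B c ->
    (forall z, (A `|` B) z <-> Y z /\ ~ V z) ->
  (A `|` L) `&` B = set0 /\ (A `|` L) `|` B = Y.
  move=> AB0 Bc ABY; split; apply/seteqP; split=> z //.
  - move=> [[Az|[[Vz|->//] Yz]] Bz].
      by have : (A `&` B) z by []; rewrite AB0.
    by have [_] := (ABY z).1 (or_intror Bz).
  - move=> [[Az|[]//]|Bz]; first by have [] := (ABY z).1 (or_introl Az).
    by have [] := (ABY z).1 (or_intror Bz).
  - move=> Yz; have [Vz|nVz] := pselect (V z).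
      by left; right; split=> //; left.
    by have [?|?] := (ABY z).2 (conj Yz nVz); [left; left|right].
(* [L] goes to [P] unless [c] is in [Q]. This includes the case where another removed lobe contains
   [c], so that [c] is on neither side. *)
have [Qc|Qc] := pselect (Q c); last first.
  have [d0 dY] := QL P Q PQ0 Qc PQY.
  by apply: (IH sV' (P `|` L) Q) => //; [exact: closedU|left].
have Pc : ~ P c by move=> Pc; have : (P `&` Q) c by []; rewrite PQ0.
have QPY z : (Q `|` P) z <-> Y z /\ ~ V z by rewrite setUC.
have [|d0 dY] := QL Q P _ Pc QPY; first by rewrite setIC.
apply: (IH sV' P (Q `|` L)) => //; first exact: closedU.
- by left.
- by rewrite setIC.
- by rewrite setUC.
Qed.

(** A countable set of reals is Lebesgue null, whereas the unit interval has measure 1. *)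
Lemma image_countable_avoids (R : realType) (T : Type) (f : T -> R)
    (F : set T) :
  countable F -> exists t : R, 0 < t < 1 /\ ~ (f @` F) t.
Proof.
move=> cF; apply: contrapT => h.
have sub : `]0, 1[%classic `<=` f @` F.
  move=> t; rewrite /= in_itv /= => t01.
  by apply: contrapT => Ft; apply: h; exists t.
have : countable (`]0, 1[%classic : set R).
  apply: sub_countable (cF); apply: card_le_trans (card_image_le f F).
  exact: subset_card_le.
move/countable_lebesgue_measure0; rewrite lebesgue_measure_itv /= lte_fin ltr01.
by rewrite -EFinB subr0 => /eqP; rewrite eqe oner_eq0.
Qed.

(** Each index is sent to the code of some point of [D] in its open set; disjointness makes this
    injective. The default of [xget] is never reached on [F]. *)
Lemma disjoint_opens_countable (X : topologicalType) (I : Type)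
    (F : set I) (V : I -> set X) :
  separable_space X -> (forall i, F i -> open (V i) /\ V i !=set0) ->
  (forall i j, F i -> F j -> i <> j -> V i `&` V j = set0) -> countable F.
Proof.
move=> [D /countable_injP[g gI] dD] oV dV; apply/countable_injP.
pose W i : set nat := [set n | exists z, [/\ V i z, D z & g z = n]].
have WP i : F i -> W i (xget 0%N (W i)).
  move=> Fi; have [oVi V0] := oV i Fi; have [z [Vz Dz]] := dD _ V0 oVi.
  by apply: (xgetPex 0%N); exists (g z), z.
exists (fun i => xget 0%N (W i)) => i j; rewrite !inE => Fi Fj.
have [z [Vz Dz <-]] := WP i Fi; have [w [Vw Dw <-]] := WP j Fj => gzw.
have zw : z = w by apply: gI => //; rewrite inE.
apply: contrapT => ij; have : (V i `&` V j) z by split=> //; rewrite zw.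
by rewrite dV.
Qed.

Lemma countable_non_cut_dendritic (R : realType) (X : topologicalType) :
  continuum X -> separable_space X -> countable (non_cut_points X) ->
  dendritic X.
Proof.
move=> [cX kX hX] sX nX; split=> // a b ab.
apply: contrapT => nsep.
have {}nsep c : ~ separated_by c a b by move=> h; apply: nsep; exists c.
pose good V := exists c : X, [/\ lobe c V, ~ V a & ~ V b].
pose F := [set x : X | forall V, good V -> ~ V x].
have cF : countable F.
  (* Points of [G] lie in no good set, so the lobes chosen at two of them avoid each other's base
     points and are disjoint. *)
  pose G := F `&` [set c | cut_point c].
  have /choice[V VP] c :
      exists V, G c -> [/\ lobe c V, V !=set0, ~ V a & ~ V b].
    have [[_ /(cut_point_lobe hX)/(_ (nsep c))[V VP]]|nG] := pselect (G c).
      by exists V.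
    by exists set0.
  have cG : countable G.
    apply: (disjoint_opens_countable (V := V)) => //.
      by move=> c /VP[[]].
    move=> c d Gc Gd cd.
    have [lc _ Va Vb] := VP c Gc; have [ld _ Wa Wb] := VP d Gd.
    apply: (lobe_disjoint cX cd) => //.
      by apply: Gc.1; exists d.
    by apply: Gd.1; exists c.
  have : countable (G `|` non_cut_points X).
    rewrite -bigcup2E; apply: bigcup_countable => //.
    by move=> -[|[|n]] _ //=; exact: countable0.
  apply: sub_countable; apply: subset_card_le => x Fx.
  by have [?|?] := pselect (cut_point x); [left|right].
have closed1 (x : X) : closed [set x].
  exact/accessible_closed_set1/hausdorff_accessible.
have : uniform_separator [set a] [set b].
  apply: (normal_uniform_separator (compact_normal hX kX)) => //.
  by apply/seteqP; split=> z //= [->].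
move/(@uniform_separatorP _ R)=> [f [cf _ fa fb]].
have {}fa : f a = 0 by apply: fa; exists a.
have {}fb : f b = 1 by apply: fb; exists b.
have [t [/andP[t0 t1] Ft]] := image_countable_avoids f cF.
have kt : compact (f @^-1` [set t]).
  apply: (subclosed_compact _ kX) => //.
  by move/continuous_closedP: cf; apply; exact: closed_eq.
(* [compact_cover] is stated for pointed spaces. *)
pose Xa : ptopologicalType :=
  HB.pack (Topological.sort X) (isPointed.Build X a).
have kE : compact (f @^-1` [set t]) = cover_compact (f @^-1` [set t]) :=
  congr1 (@^~ (f @^-1` [set t])) (@compact_cover Xa).
have [] := (eq_ind _ id kt _ kE) (set X) good id.
- by move=> V [c [[]]].
- move=> z /= fz; apply: contrapT => nz; apply: Ft; exists z => // V gV Vz.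
  by apply: nz; exists V.
move=> D' D'good ts.
pose s : seq (set X) := finmap.enum_fset D'.
have sgood V : V \in s -> good V by move=> Vs; have /set_mem := D'good _ Vs.
pose Z := [set z : X | forall V, V \in s -> ~ V z].
have clZ : closed Z by apply: closed_avoid => V /sgood[c [[]]].
have Zt z : Z z -> f z <> t.
  by move=> Zz fz; have [V Vs Vz] := ts z fz; exact: Zz Vs Vz.
(* Cutting [Z] at level [t] gives two closed pieces, disjoint because [f] misses [t] on [Z]. *)
apply: (lobes_nonseparating cX sgood (P := [set z | f z <= t] `&` Z)
  (Q := [set z | t <= f z] `&` Z)).
- apply: closedI => //.
  exact: (iffLR (continuous_closedP f) cf _ (@closed_le R t)).
- apply: closedI => //.
  exact: (iffLR (continuous_closedP f) cf _ (@closed_ge R t)).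
- by split; rewrite /= ?fa ?(ltW t0) // => V /sgood[c []].
- by split; rewrite /= ?fb ?(ltW t1) // => V /sgood[c []].
- apply/seteqP; split=> z //= [[fz Zz] [tf _]]; apply: (Zt z Zz).
  by apply/eqP; rewrite eq_le fz tf.
- rewrite -setIUl; apply/seteqP; split=> z; first by case.
  by move=> Zz; split=> //=; case/orP: (le_total (f z) t) => ?; [left|right].
Qed.

(** * A countable family of functions separating points *)

Lemma dendritic_separating_sequence (R : realType) (X : topologicalType) :
  dendritic X -> compact [set: X] -> hausdorff_space X -> separable_space X ->
  exists f : nat -> X -> R, [/\ forall n, continuous (f n),
    forall n x, 0 <= f n x <= 1 &
    forall x y, x <> y -> exists n, f n x <> f n y].
Proof.
move=> dX kX hX [D /countable_injP[g gI] dD].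
pose code d e d' e' := pickle (g d, g e, g d', g e').
pose P n (f : X -> R) := [/\ continuous f, forall x, 0 <= f x <= 1 &
  exists d e d' e', [/\ D d, D e, D d' & D e'] /\ code d e d' e' = n /\
  exists c U V c' U' V', [/\ splits c U V, splits c' U' V',
    [/\ U d, U e & V e'], [/\ U' d', U' e' & V' e] &
    (forall z, U z -> f z = 0) /\ (forall z, U' z -> f z = 1)]].
(* When [n] codes no admissible quadruple, [f n] is the zero function. *)
pose f n := xget (fun=> 0) (P n).
have fP n : continuous (f n) /\ forall x, 0 <= f n x <= 1.
  rewrite /f; case: xgetP => [h _ [ch h01 _]|_]; first by split.
  by split=> [|x]; [exact: cst_continuous|rewrite lexx ler01].
exists f; split=> [n|n|x y xy]; [exact: (fP n).1|exact: (fP n).2|].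
have [cX /(_ x y xy)[c0 [U0 [V0 [oU0 oV0 UV0 UV0c [U0x V0y]]]]]] := dX.
have s0 : splits c0 U0 V0 by [].
have [d [e [c [U [V [[Dd De Ud Ue] [s UU0 V0V pinx]]]]]]] :=
  splits_side dX dD s0 U0x.
have [d' [e' [c' [U' [V' [[Dd' De' Ud' Ue'] [s' U'V0 U0V' piny]]]]]]] :=
  splits_side dX dD (splitsC s0) V0y.
have [h hP] : exists h, P (code d e d' e') h; last first.
  exists (code d e d' e').
  have [_ _ [d1 [e1 [d2 [e2 [[D1 D2 D3 D4] [codeE]]]]]]] :
    P (code d e d' e') (f (code d e d' e')) by apply: xgetPex; exists h.
  have [] : (g d1, g e1, g d2, g e2) = (g d, g e, g d', g e').
    exact: (pcan_inj pickleK codeE).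
  do 4![move=> /gI-/(_ (mem_set _) (mem_set _))->//].
  (* The points [k] and [k'] behind the chosen function may differ from [c] and [c']. Since [pinx]
     and [piny] apply to any such splittings, they still place [x] in [A] and [y] in [A']. *)
  move=> [k [A [B [k' [A' [B' [sA sA' [Ad Ae Be'] [Ad' Ae' Be] [f0 f1]]]]]]]].
  have Ax : A x.
    by apply: (pinx e' _ _ _ _ sA) => //; apply: V0V; left; apply: U'V0; left.
  have A'y : A' y.
    by apply: (piny e _ _ _ _ sA') => //; apply: U0V'; left; apply: UU0; left.
  by rewrite f0// f1// => /esym/eqP; rewrite oner_eq0.
have [_ _ clU] := splits_lobe s; have [_ _ clU'] := splits_lobe s'.
have : uniform_separator (U `|` [set c]) (U' `|` [set c']).
  apply: (normal_uniform_separator (compact_normal hX kX)) => //.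
  apply/seteqP; split=> z //= [/UU0 U0z /U'V0].
  exact: splits_disjoint s0 U0z.
move=> /(@uniform_separatorP _ R)[h [ch h01 h0 h1]].
exists h; split=> //.
  by move=> z; have /h01 : range h (h z) by exists z.
exists d, e, d', e'; split=> //; split=> //.
exists c, U, V, c', U', V'; split=> //.
- by split=> //; apply: V0V; left; apply: U'V0; left.
- by split=> //; apply: U0V'; left; apply: UU0; left.
- by split=> z Uz; [apply: h0|apply: h1]; exists z => //; left.
Qed.

(** * From a separating sequence to a metric *)

Lemma compact_hausdorff_inverse_continuous (X Y : topologicalType)
    (f : X -> Y) (g : Y -> X) :
  compact [set: X] -> hausdorff_space Y -> continuous f ->
  cancel f g -> cancel g f -> continuous g.
Proof.
move=> kX hY cf fK gK; apply/continuous_closedP => A clA.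
have -> : g @^-1` A = f @` A.
  by apply/seteqP; split=> [y Ay|_ [x Ax <-]] /=; [exists (g y)|rewrite fK].
apply: compact_closed => //; apply: continuous_compact.
  exact: continuous_subspaceT.
exact: subclosed_compact kX _.
Qed.

(** A Hilbert cube metric pulled back along [f]. A supremum with weights tending to 0 replaces the
    usual weighted series. *)
Definition weighted_dist (R : realType) (X : Type) (f : nat -> X -> R)
    (x y : X) : R :=
  sup (range (fun n => `|f n x - f n y| / n.+1%:R)).

Lemma weighted_dist_le (R : realType) (X : Type) (f : nat -> X -> R) x y e :
  (forall n, `|f n x - f n y| / n.+1%:R <= e) -> weighted_dist f x y <= e.
Proof.
move=> fe; apply: ge_sup.
  by exists (`|f 0%N x - f 0%N y| / 1%:R); exists 0%N.
by move=> _ [n _ <-].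
Qed.

Section weighted_dist_theory.
Context (R : realType) (X : Type) (f : nat -> X -> R).
Context (f01 : forall n x, 0 <= f n x <= 1).

Lemma weighted_term_le n x y : `|f n x - f n y| / n.+1%:R <= n.+1%:R^-1.
Proof.
rewrite ler_pdivrMr ?ltr0n// mulVf ?pnatr_eq0// ler_norml.
have /andP[x0 x1] := f01 n x; have /andP[y0 y1] := f01 n y.
by apply/andP; split; lra.
Qed.

Lemma weighted_dist_ge n x y :
  `|f n x - f n y| / n.+1%:R <= weighted_dist f x y.
Proof.
apply: ub_le_sup; last by exists n.
exists 1 => _ [m _ <-]; apply: (le_trans (weighted_term_le m x y)).
by rewrite invf_le1 ?ltr0n// ler1n.
Qed.

Lemma weighted_distxx x : weighted_dist f x x = 0.
Proof.
apply/eqP; rewrite eq_le; apply/andP; split.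
  by apply: weighted_dist_le => n; rewrite subrr normr0 mul0r.
by have := weighted_dist_ge 0%N x x; rewrite subrr normr0 mul0r.
Qed.

Lemma weighted_dist_sym x y : weighted_dist f x y = weighted_dist f y x.
Proof.
by congr (sup _); apply: eq_imagel => n _; rewrite distrC.
Qed.

Lemma weighted_dist_triangle y x z :
  weighted_dist f x z <= weighted_dist f x y + weighted_dist f y z.
Proof.
apply: weighted_dist_le => n.
apply: le_trans (lerD (weighted_dist_ge n x y) (weighted_dist_ge n y z)).
by rewrite -mulrDl ler_wpM2r ?invr_ge0// ler_distD.
Qed.

Context (fsep : forall x y, x <> y -> exists n, f n x <> f n y).

Lemma weighted_dist_positivity x y : weighted_dist f x y = 0 -> x = y.
Proof.
move=> d0; apply: contrapT => /fsep[n]; apply.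
have := weighted_dist_ge n x y; rewrite d0 pmulr_lle0 ?invr_gt0 ?ltr0n//.
by rewrite normr_le0 subr_eq0 => /eqP.
Qed.

End weighted_dist_theory.

(* An alias of [X] carrying the metric topology instead of the given one. *)
Definition weighted_space (R : realType) (X : choiceType) (f : nat -> X -> R)
  (f01 : forall n x, 0 <= f n x <= 1)
  (fsep : forall x y, x <> y -> exists n, f n x <> f n y) : Type := X.

Section weighted_space_metric.
Context (R : realType) (X : choiceType) (f : nat -> X -> R).
Context (f01 : forall n x, 0 <= f n x <= 1).
Context (fsep : forall x y, x <> y -> exists n, f n x <> f n y).

HB.instance Definition _ := Choice.on (weighted_space f01 fsep).
HB.instance Definition _ := @isMetric.Build R (weighted_space f01 fsep)
  (weighted_dist f) (weighted_distxx f01) (weighted_dist_positivity f01 fsep)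
  (weighted_dist_sym f) (weighted_dist_triangle f01).

End weighted_space_metric.

(** The weights make all terms from some [N] on uniformly small; continuity controls the finitely
    many others near [x]. *)
Lemma weighted_space_continuous (R : realType) (X : topologicalType)
    (f : nat -> X -> R) (f01 : forall n x, 0 <= f n x <= 1)
    (fsep : forall x y, x <> y -> exists n, f n x <> f n y) :
  (forall n, continuous (f n)) ->
  continuous (id : X -> weighted_space f01 fsep).
Proof.
move=> cf x; apply/metricType_numDomainType.cvgrPdist_lt => eps eps0.
(* Half of [eps] leaves room for the supremum, which preserves only non-strict bounds. *)
have e20 : 0 < eps / 2 by rewrite divr_gt0.
have [N _ NP] := near_infty_natSinv_lt (PosNum e20).
have near_lt : \forall y \near x, forall n : 'I_N, `|f n x - f n y| < eps / 2.
  apply: filter_forall => n.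
  by move/cvgrPdist_lt: (cf n x); apply.
near=> y.
have yN : forall n : 'I_N, `|f n x - f n y| < eps / 2 by near: y.
suff : weighted_dist f x y <= eps / 2 by move/le_lt_trans; apply; lra.
apply: weighted_dist_le => n; have [nN|Nn] := ltnP n N.
  apply: le_trans (ltW (yN (Ordinal nN))).
  by rewrite ler_pdivrMr ?ltr0n// ler_peMr// ler1n.
by apply: (le_trans (weighted_term_le f01 n x y)); apply/ltW/NP.
Unshelve. all: by end_near. Qed.

(** The identity onto the metric alias is a continuous bijection from a compact space to a Hausdorff
    space, hence a homeomorphism. *)
Lemma metrizable_of_separating_sequence (R : realType) (X : topologicalType)
    (f : nat -> X -> R) :
  compact [set: X] -> (forall n, continuous (f n)) ->
  (forall n x, 0 <= f n x <= 1) ->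
  (forall x y, x <> y -> exists n, f n x <> f n y) ->
  metrizable R X.
Proof.
move=> kX cf f01 fsep.
exists (weighted_space f01 fsep), id, id.
have cid : continuous (id : X -> weighted_space f01 fsep).
  exact: weighted_space_continuous.
split=> //.
apply: compact_hausdorff_inverse_continuous kX _ cid _ _ => //.
exact: metric_hausdorff.
Qed.

Theorem corollary2p3 (R : realType) (X : topologicalType)
  (hX : continuum X) (hsep : separable_space X)
  (hncut : countable (non_cut_points X)) :
  dendrite R X.
Proof.
have dX := countable_non_cut_dendritic R hX hsep hncut.
have [_ kX hausX] := hX; split=> //.
have [f [cf f01 fsep]] := dendritic_separating_sequence R dX kX hausX hsep.
exact: metrizable_of_separating_sequence kX cf f01 fsep.
Qed.
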